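(* Let $q=p^l$ be a prime power ($p$ prime) and $\mathbb{F}_q$ the finite field of order $q$. Let $\mathcal{D}$ be a $1$-$(v,k,r)$ design with blocks $B_1,\ldots,B_b$ such that $k\equiv 0\pmod p$ and $|B_i\cap B_j|\equiv 0\pmod p$ for all $i,j\in\{1,\ldots,b\}$, $i\neq j$. Let $G$ be an automorphism group of $\mathcal{D}$ which acts on $\mathcal{D}$ with $n$ point orbits, all of length $w$, and $m$ block orbits, all of length $w$. Let $O$ be the orbit matrix of $\mathcal{D}$ under the action of $G$. Then the linear code over $\mathbb{F}_q$ spanned by the rows of $O$ is a self-orthogonal code over $\mathbb{F}_q$ of length $\frac{v}{w}$ and dimension $\operatorname{rank} O$ (rank over $\mathbb{F}_q$).
   Context: A $1$-$(v,k,r)$ design is a finite incidence structure with $v$ points and $b$ blocks such that every block is incident with exactly $k$ points and every point is incident with exactly $r$ blocks. For blocks $B_i,B_j$, $|B_i\cap B_j|$ is the number of points incident with both. An automorphism group of $\mathcal{D}$ is a group of incidence-preserving bijections (points to points, blocks to blocks) of $\mathcal{D}$. If $G$ has point orbits $\mathcal{V}_1,\ldots,\mathcal{V}_n$ and block orbits $\mathcal{B}_1,\ldots,\mathcal{B}_m$, the orbit matrix is the $m\times n$ matrix $[a_{i,j}]$ where $a_{i,j}$ is the number of points of $\mathcal{V}_j$ incident with a block of $\mathcal{B}_i$ (independent of the chosen block); its entries are viewed in the field under consideration. A code $C\subseteq\mathbb{F}^n$ is self-orthogonal if $C\subseteq C^\perp$, where $C^\perp$ is the dual under the standard (bilinear)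 inner product. *)

(* Defs.v *)
From HB Require Import structures.
From mathcomp Require Import all_boot all_order all_algebra all_fingroup.

Set Implicit Arguments.
Unset Strict Implicit.
Unset Printing Implicit Defensive.

Section Designs.

Variables (X Y : finType).
Implicit Types (inc : X -> Y -> bool) (x : X) (y : Y).

(* Blocks are elements of [Y] rather than sets of points, so distinct blocks
   may be incident with the same points. *)
Definition block_pts inc y : {set X} := [set x | inc x y].

Definition is_1_design inc (v k r : nat) : Prop :=
  [/\ #|X| = v,
      forall y, #|block_pts inc y| = k
    & forall x, #|[set y | inc x y]| = r].

Definition automorphisms inc : {set {perm X} * {perm Y}} :=
  [set g : {perm X} * {perm Y} |
    [forall x, forall y, inc (g.1 x) (g.2 y) == inc x y]].

Fact point_act_is_action :
  is_action [set: {perm X} * {perm Y}] (fun x (g : {perm X} * {perm Y}) => g.1 x).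
Proof.
by apply: is_total_action => [x | x g h]; rewrite /= ?perm1 ?permM.
Qed.
Definition point_act : {action ({perm X} * {perm Y}) &-> X} :=
  Action point_act_is_action.

Fact block_act_is_action :
  is_action [set: {perm X} * {perm Y}] (fun y (g : {perm X} * {perm Y}) => g.2 y).
Proof.
by apply: is_total_action => [y | y g h]; rewrite /= ?perm1 ?permM.
Qed.
Definition block_act : {action ({perm X} * {perm Y}) &-> Y} :=
  Action block_act_is_action.

End Designs.

Definition enumerates_orbits (gT : finGroupType) (T : finType)
    (to : {action gT &-> T}) (G : {set gT}) (n : nat)
    (S : 'I_n -> {set T}) : Prop :=
  injective S /\ [set S i | i : 'I_n] = orbit to G @: [set: T].

(* The default value 0 is never used when [BO i] is an orbit, and then the
   entry does not depend on the block picked: see [orbit_matrixE]. *)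
Definition orbit_matrix (X Y : finType) (inc : X -> Y -> bool) (m n : nat)
    (VO : 'I_n -> {set X}) (BO : 'I_m -> {set Y}) : 'M[nat]_(m, n) :=
  \matrix_(i < m, j < n)
    if [pick y in BO i] is Some y then #|VO j :&: block_pts inc y| else 0%N.

Lemma orbit_matrixE (X Y : finType) (inc : X -> Y -> bool)
    (G : {group {perm X} * {perm Y}}) (m n : nat)
    (VO : 'I_n -> {set X}) (BO : 'I_m -> {set Y}) :
    G \subset automorphisms inc ->
    enumerates_orbits (point_act X Y) G VO ->
    enumerates_orbits (block_act X Y) G BO ->
  forall i j y, y \in BO i ->
  orbit_matrix inc VO BO i j = #|VO j :&: block_pts inc y|.
Proof.
move=> /subsetP GA [_ VE] [_ BE] i j y yi; rewrite mxE.
case: pickP => [z zi | /(_ y)]; last by rewrite yi.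
have /imsetP[b _ Bi] : BO i \in orbit (block_act X Y) G @: [set: Y].
  by rewrite -BE imset_f.
have /imsetP[a _ Vj] : VO j \in orbit (point_act X Y) G @: [set: X].
  by rewrite -VE imset_f.
move: yi zi; rewrite Bi orbit_sym => yb zb.
have /orbitP[g Gg /= gz] := orbit_trans zb yb.
have incg x t : inc (g.1 x) (g.2 t) = inc x t.
  by have := GA g Gg; rewrite inE => /forallP/(_ x)/forallP/(_ t)/eqP.
have Vg x : (g.1 x \in VO j) = (x \in VO j).
  by rewrite Vj -!orbit_eq_mem -(orbit_act (point_act X Y) x Gg).
rewrite -gz -[RHS](card_imset _ (@perm_inj _ g.1)); congr #|pred_of_set _|.
apply/setP=> x; apply/idP/imsetP => [xV | [u uV ->]].
  exists ((g.1)^-1%g x); last by rewrite permKV.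
  by move: xV; rewrite !inE -{1 2}[x](permKV g.1) Vg incg.
by move: uV; rewrite !inE Vg incg.
Qed.

Section Codes.

Local Open Scope ring_scope.

Variables (F : finFieldType) (n : nat).
Implicit Types (u c : 'rV[F]_n) (C : {vspace 'rV[F]_n}).

Definition dotp u c : F := \sum_(i < n) u 0 i * c 0 i.

Definition dual_code C : {set 'rV[F]_n} :=
  [set u | [forall c in C, dotp u c == 0]].

Definition self_orthogonal C : Prop := {subset C <= dual_code C}.

Definition row_code (m : nat) (O : 'M[F]_(m, n)) : {vspace 'rV[F]_n} :=
  <<[seq row i O | i : 'I_m]>>%VS.

End Codes.

(* Main.v *)
Require Import Defs.
From HB Require Import structures.
From mathcomp Require Import all_boot all_order all_algebra all_fingroup.
From mathcomp Require Import finfield.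

Set Implicit Arguments.
Unset Strict Implicit.
Unset Printing Implicit Defensive.

Import GRing.Theory.
Local Open Scope ring_scope.

(** With all orbits of the same length w, the orbit matrix O satisfies
    O O^T = 0 over F, for the following reason.  Fix a point orbit V and a
    block orbit B.  By transitivity every point of V lies on the same number of
    blocks of B, and every block of B meets V in the same number of points;
    counting the flags of V x B in two ways shows that these two numbers agree,
    because |V| = |B| = w (lemma [orbit_replication]).  Hence, for a block y of
    any orbit, the inner product of the row of y with the row of B counts the
    pairs (x, z) with x on y, z in B and x on z, and so equals the sum of
    |y :&: z| over the blocks z of B (lemma [orbit_row_product]).  Each term
    vanishes modulo p, the term z = y because it is k.

    The code is the row space of O (lemma [mem_row_code]), so O O^T = 0 says
    that it is self-orthogonal, and its dimension is the rank of O.  Its length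
    n is the number of parts of size w in the partition of the v points into
    orbits. *)

(** * Row spaces as codes *)

Section RowCode.

Variables (F : finFieldType) (n : nat).

(** The rows as a tuple: coordinates and freeness are indexed by ordinals. *)
Lemma row_seqE m (O : 'M[F]_(m, n)) :
  [seq row i O | i : 'I_m] = [tuple row i O | i < m].
Proof. by rewrite /= /image_mem; congr map; rewrite enumT. Qed.

(** Vector subspaces carry the dimension in the statement, whereas ranks and
    products are computed with matrices; membership is the bridge. *)
Lemma mem_row_code m (O : 'M[F]_(m, n)) (u : 'rV[F]_n) :
  (u \in row_code O) = (u <= O)%MS.
Proof.
apply/idP/submxP => [|[a ->]]; rewrite /row_code.
  rewrite row_seqE => /coord_span ->.
  set a := coord _; exists (\row_j a j u); rewrite mulmx_sum_row.
  by apply: eq_bigr => j _; rewrite mxE -tnth_nth tnth_mktuple.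
rewrite mulmx_sum_row; apply: rpred_sum => j _; apply: rpredZ.
by apply: memv_span; apply: map_f; rewrite mem_enum.
Qed.

Lemma dim_row_code_free m (O : 'M[F]_(m, n)) :
  row_free O -> \dim (row_code O) = m.
Proof.
move=> freeO; suff /eqP : free [seq row i O | i : 'I_m].
  by rewrite size_map size_enum_ord.
rewrite row_seqE; apply/freeP => a a0 i.
have : (\row_j a j) *m O = 0.
  rewrite mulmx_sum_row -[RHS]a0; apply: eq_bigr => j _.
  by rewrite mxE -tnth_nth tnth_mktuple.
by rewrite -(mul0mx _ O) => /(row_free_inj freeO)/rowP/(_ i); rewrite !mxE.
Qed.

(** A row base spans the same code with independent rows. *)
Lemma dim_row_code m (O : 'M[F]_(m, n)) : \dim (row_code O) = \rank O.
Proof.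
rewrite -(dim_row_code_free (row_base_free O)); congr (\dim _).
by apply/vspaceP=> u; rewrite !mem_row_code eq_row_base.
Qed.

Lemma dotpE (u c : 'rV[F]_n) : dotp u c = (u *m c^T) 0 0.
Proof. by rewrite mxE; apply: eq_bigr => i _; rewrite mxE. Qed.

Lemma self_orthogonal_row_code m (O : 'M[F]_(m, n)) :
  O *m O^T = 0 -> self_orthogonal (row_code O).
Proof.
move=> OO u; rewrite mem_row_code inE => /submxP[a ->].
apply/forall_inP => c; rewrite mem_row_code => /submxP[b ->].
by rewrite dotpE trmx_mul mulmxA -(mulmxA a) OO mulmx0 mul0mx mxE.
Qed.

End RowCode.

(** * Counting along orbits *)

Section Orbits.

Variables (gT : finGroupType) (T : finType) (to : {action gT &-> T}).
Variables (G : {group gT}) (n : nat) (S : 'I_n -> {set T}).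
Hypothesis S_orbits : enumerates_orbits to G S.

Lemma enum_orbit i t : t \in S i -> S i = orbit to G t.
Proof.
case: S_orbits => _ SE; have : S i \in orbit to G @: [set: T].
  by rewrite -SE imset_f.
by case/imsetP=> a _ ->; rewrite -orbit_eq_mem => /eqP.
Qed.

Lemma enum_orbit_neq0 i : exists t, t \in S i.
Proof.
case: S_orbits => _ SE; have : S i \in orbit to G @: [set: T].
  by rewrite -SE imset_f.
by case/imsetP=> a _ ->; exists a; apply: orbit_refl.
Qed.

Lemma orbits_partition : partition [set S i | i : 'I_n] [set: T].
Proof.
case: S_orbits => _ ->; apply: orbit_partition.
by apply/actsP=> g _ t; rewrite !inE.
Qed.

Lemma sum_orbits (f : T -> nat) :
  (\sum_(j < n) \sum_(t in S j) f t = \sum_t f t)%N.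
Proof.
have [injS _] := S_orbits.
have /and3P[/eqP covS trivS _] := orbits_partition.
transitivity (\sum_(t in [set: T]) f t)%N.
  rewrite -covS big_trivIset // big_imset //=.
  by move=> i j _ _; apply: injS.
by apply: eq_bigl => t; rewrite inE.
Qed.

Lemma card_orbits w : (forall j, #|S j| = w) -> #|T| = (n * w)%N.
Proof.
move=> Sw; rewrite -sum1_card -(sum_orbits (fun=> 1%N)).
by under eq_bigr => j _ do rewrite sum1_card Sw; rewrite sum_nat_const card_ord.
Qed.

End Orbits.

Section OrbitMatrix.

Variables (X Y : finType) (inc : X -> Y -> bool).
Variables (G : {group {perm X} * {perm Y}}) (n m w : nat).
Variables (VO : 'I_n -> {set X}) (BO : 'I_m -> {set Y}).
Hypothesis G_aut : G \subset automorphisms inc.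
Hypothesis VO_orbits : enumerates_orbits (point_act X Y) G VO.
Hypothesis BO_orbits : enumerates_orbits (block_act X Y) G BO.
Hypothesis VO_length : forall j, #|VO j| = w.
Hypothesis BO_length : forall i, #|BO i| = w.

Lemma replication_const i j x x' : x \in VO j -> x' \in VO j ->
  #|[set y in BO i | inc x y]| = #|[set y in BO i | inc x' y]|.
Proof.
move=> xV; rewrite (enum_orbit VO_orbits xV) => /orbitP[g Gg /= <-].
have incg z t : inc (g.1 z) (g.2 t) = inc z t.
  have := subsetP G_aut g Gg.
  by rewrite inE => /forallP/(_ z)/forallP/(_ t)/eqP.
have [b bB] := enum_orbit_neq0 BO_orbits i.
have BOg t : (g.2 t \in BO i) = (t \in BO i).
  rewrite (enum_orbit BO_orbits bB) -!orbit_eq_mem.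
  by rewrite -(orbit_act (block_act X Y) t Gg).
rewrite -(card_imset _ (@perm_inj _ g.2)); congr #|pred_of_set _|.
apply/setP=> t; apply/imsetP/idP => [[z + ->]|].
  by rewrite !inE BOg incg.
rewrite inE -{1 2}[t](permKV g.2) BOg incg => tB.
by exists ((g.2)^-1%g t); rewrite ?inE // permKV.
Qed.

(** Both sides, multiplied by w, count the flags between [VO j] and [BO i]. *)
Lemma orbit_replication i j x : x \in VO j ->
  #|[set y in BO i | inc x y]| = orbit_matrix inc VO BO i j.
Proof.
move=> xV; have w_gt0 : (0 < w)%N.
  by rewrite -(VO_length j); apply/card_gt0P; exists x.
apply/eqP; rewrite -(eqn_pmul2l w_gt0); apply/eqP.
transitivity (\sum_(z in VO j) \sum_(y in BO i) inc z y)%N.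
  rewrite -{1}(VO_length j) -sum_nat_const; apply: eq_bigr => z zV.
  by rewrite (replication_const i xV zV) -sum1dep_card big_mkcondr.
rewrite exchange_big /= -[in RHS](BO_length i) -sum_nat_const.
apply: eq_bigr => y yB.
rewrite (orbit_matrixE G_aut VO_orbits BO_orbits j yB) -sum1_card.
by rewrite -big_mkcondr; apply: eq_bigl => z; rewrite !inE.
Qed.

(** Trading one entry of each product for a replication number turns the sum
    over point orbits into a sum over the points of the block y. *)
Lemma orbit_row_product i s y : y \in BO i ->
  (\sum_(j < n) orbit_matrix inc VO BO i j * orbit_matrix inc VO BO s j
   = \sum_(z in BO s) #|block_pts inc y :&: block_pts inc z|)%N.
Proof.
move=> yB.
transitivity (\sum_x inc x y * #|[set z in BO s | inc x z]|)%N.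
  rewrite -(sum_orbits VO_orbits); apply: eq_bigr => j _.
  rewrite (orbit_matrixE G_aut VO_orbits BO_orbits j yB).
  rewrite -sum1_card big_distrl /=.
  rewrite (eq_bigl (fun x => (x \in VO j) && inc x y)); last first.
    by move=> x; rewrite !inE.
  rewrite big_mkcondr; apply: eq_bigr => x xV.
  by rewrite (orbit_replication s xV); case: inc; rewrite ?mul0n.
transitivity (\sum_x \sum_(z in BO s) (inc x y && inc x z))%N.
  apply: eq_bigr => x _; rewrite -sum1dep_card big_mkcondr big_distrr /=.
  by apply: eq_bigr => z _; case: inc; case: inc.
rewrite exchange_big; apply: eq_bigr => z _.
rewrite -sum1_card -big_mkcond /=.
by apply: eq_bigl => x; rewrite !inE.
Qed.

Lemma orbit_row_product_dvd p k i s :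
    (forall y, #|block_pts inc y| = k) -> (p %| k)%N ->
    (forall y1 y2, y1 != y2 ->
       (p %| #|block_pts inc y1 :&: block_pts inc y2|)%N) ->
  (p %| \sum_(j < n) orbit_matrix inc VO BO i j * orbit_matrix inc VO BO s j)%N.
Proof.
move=> block_size p_k p_inter.
have [y yB] := enum_orbit_neq0 BO_orbits i.
rewrite (orbit_row_product s yB); apply: dvdn_sum => z _.
by have [->|/p_inter//] := eqVneq y z; rewrite setIid block_size.
Qed.

End OrbitMatrix.

(** * Self-orthogonality of the orbit code *)

Theorem theorem7
    (p l q : nat) (F : finFieldType)
    (p_prime : prime p) (l_gt0 : (0 < l)%N) (q_def : q = (p ^ l)%N)
    (cardF : #|F| = q)
    (X Y : finType) (inc : X -> Y -> bool) (v k r : nat)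
    (design : is_1_design inc v k r)
    (k_mod : k = 0 %[mod p])
    (inter_mod : forall y1 y2 : Y, y1 != y2 ->
       #|block_pts inc y1 :&: block_pts inc y2| = 0 %[mod p])
    (G : {group {perm X} * {perm Y}})
    (G_aut : G \subset automorphisms inc)
    (n m w : nat)
    (VO : 'I_n -> {set X}) (BO : 'I_m -> {set Y})
    (VO_orbits : enumerates_orbits (point_act X Y) G VO)
    (BO_orbits : enumerates_orbits (block_act X Y) G BO)
    (VO_length : forall j, #|VO j| = w)
    (BO_length : forall i, #|BO i| = w) :
  let O : 'M[F]_(m, n) :=
    \matrix_(i, j) (orbit_matrix inc VO BO i j)%:R in
  let C : {vspace 'rV[F]_n} := row_code O in
  [/\ self_orthogonal C,
      (w %| v)%N,
      n = (v %/ w)%N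
    & \dim C = \rank O].
Proof.
case: design => cardX block_size _ /=; split; last exact: dim_row_code.
- have charF : p \in [pchar F].
    by apply: (@card_finPcharP F p l); rewrite ?cardF.
  have dvdA i s : (p %| \sum_(j < n)
      orbit_matrix inc VO BO i j * orbit_matrix inc VO BO s j)%N.
    apply: (orbit_row_product_dvd G_aut VO_orbits BO_orbits VO_length BO_length
              i s block_size).
      by rewrite /dvdn k_mod mod0n.
    by move=> y1 y2 /inter_mod y12; rewrite /dvdn y12 mod0n.
  apply: self_orthogonal_row_code; apply/matrixP=> i s.
  move: (orbit_matrix inc VO BO) dvdA => A dvdA; rewrite !mxE.
  under eq_bigr => j _ do rewrite !mxE -natrM.
  by rewrite -natr_sum; apply/eqP; rewrite -(dvdn_pcharf charF).
- by rewrite -cardX (card_orbits VO_orbits VO_length) dvdn_mull.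
rewrite -cardX (card_orbits VO_orbits VO_length).
(* When there are no points, w may be 0, but then so is n. *)
case: n VO VO_orbits VO_length => [|n'] VO' VO_orb VO_len.
  by rewrite mul0n div0n.
have [x xV] := enum_orbit_neq0 VO_orb ord0.
by rewrite mulnK // -(VO_len ord0); apply/card_gt0P; exists x.
Qed.
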